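(* Let $d_0\ge2$ be an integer and $0<\delta<\frac12$. Let $\mathcal{G}_{\mathrm{ext}}=\mathcal{G}_{\mathrm{ext}}(d_0,\delta)$ be the class of finite connected graphs $G$ with $|G|\ge2$ and $\deg(G)\le d_0$ such that either $\lambda_G\le|G|^{-2(1-\delta)}(\log|G|)^{-1}$ or $\lambda_G\ge|G|^{-\delta/10}$. Then $$\lim_{|G|\to\infty,\ G\in\mathcal{G}_{\mathrm{ext}}}\ \sup_{x\in E}P_x\big[\mathcal{T}_G\le|G|^{2(1-\delta)}\big]=0,$$ where $E=G\times\mathbb{Z}$ and the limit is uniform over $G\in\mathcal{G}_{\mathrm{ext}}$ as $|G|\to\infty$.
   Context: Graphs are simple and undirected and identified with their vertex sets; $|G|$ is the number of vertices, $\deg(G)$ the maximal number of neighbors of a vertex, $g\sim g'$ means neighbors. The cylinder $E=G\times\mathbb{Z}$ has the product graph structure ($(g,u)\sim(g',u')$ iff $g=g'$, $|u-u'|=1$ or $u=u'$, $g\sim g'$). $P_x$, $x\in E$, is the law of the discrete-time simple random walk $(X_n)_{n\ge0}$ on $E$ from $x$ (uniform jumps to neighbors). A finite $S\subseteq E$ disconnects $E$ if for large $M$, $G\times[M,\infty)$ and $G\times(-\infty,-M]$ lie in two distinct connected components of $E\setminus S$; $\mathcal{T}_G=\inf\{n\ge0:\{X_0,\dots,X_n\}\text{ disconnects }E\}$. The spectral gap is $\lambda_G=\inf_f\mathcal{D}_G(f,f)/\mathrm{var}(f)$ over nonconstant $f:G\to\mathbb{R}$, where $\mathcal{D}_G(f,f)=\frac1{2|G|}\sum_{g,g'\in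 G,\,g\sim g'}(f(g')-f(g))^2$ and $\mathrm{var}$ is the variance under the uniform distribution on $G$. *)

(* Defs.v *)
From HB Require Import structures.
From mathcomp Require Import all_boot all_order all_algebra.
From mathcomp Require Import all_classical all_reals all_analysis.

Set Implicit Arguments.
Unset Strict Implicit.
Unset Printing Implicit Defensive.

Import Order.TTheory GRing.Theory Num.Theory.
Import numFieldNormedType.Exports.

Local Open Scope classical_set_scope.
Local Open Scope ring_scope.

Record sgraph := SGraph {
  vertex :> finType;
  adj : rel vertex;
  adj_sym : symmetric adj;
  adj_irr : irreflexive adj }.

Arguments adj {s}.

Definition graph_connected (G : sgraph) : Prop :=
  forall g g' : G, connect (@adj G) g g'.

Definition vdeg (G : sgraph) (g : G) : nat := #|[pred g' | adj g g']|.

Definition max_deg (G : sgraph) : nat := (\max_(g : G) vdeg g)%N.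

Section SpectralGap.
Variables (R : realType) (G : sgraph).
Implicit Type f : G -> R.

Definition dirichlet f : R :=
  (2 * #|G|%:R)^-1 * \sum_(g : G) \sum_(g' : G | adj g g') (f g' - f g) ^+ 2.

Definition umean f : R := #|G|%:R^-1 * \sum_(g : G) f g.

Definition uvar f : R := #|G|%:R^-1 * \sum_(g : G) (f g - umean f) ^+ 2.

Definition nonconstant f : Prop := exists g g' : G, f g <> f g'.

(* The infimum of reals is meaningful when [2 <= #|G|]: the set is then nonempty
   (and always bounded below by 0). *)
Definition spectral_gap : R :=
  inf [set dirichlet f / uvar f | f in nonconstant].

End SpectralGap.

Definition Gext (R : realType) (d0 : nat) (delta : R) (G : sgraph) : Prop :=
  [/\ graph_connected G, (2 <= #|G|)%N, (max_deg G <= d0)%N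
    & spectral_gap R G <= #|G|%:R `^ (- (2 * (1 - delta))) * (ln #|G|%:R)^-1
      \/ #|G|%:R `^ (- (delta / 10)) <= spectral_gap R G].

Section Cylinder.
Variable G : sgraph.

Definition cyl_adj : rel (G * int) := fun a b =>
  ((a.1 == b.1) && (`|a.2 - b.2| == 1)) || ((a.2 == b.2) && adj a.1 b.1).

Definition cyl_nbrs (a : G * int) : seq (G * int) :=
  [:: (a.1, a.2 + 1), (a.1, a.2 - 1) & [seq (g, a.2) | g <- enum (adj a.1)]].

Lemma mem_cyl_nbrs a b : (b \in cyl_nbrs a) = cyl_adj a b.
Proof.
case: a b => [g u] [h v]; rewrite /cyl_nbrs /cyl_adj /= !inE !xpair_eqE /=.
have -> : ((h, v) \in [seq (g', u) | g' <- enum (adj g)])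
          = (u == v) && adj g h.
  apply/mapP/andP => [[k + [-> ->]]|[/eqP <- gh]]; first by rewrite mem_enum.
  by exists h => //; rewrite mem_enum.
rewrite orbA -andb_orr (eq_sym g h); congr (_ && _ || _).
rewrite distrC eqr_norml ler01 andbT !subr_eq [1 + u]addrC.
by rewrite [-1 + u]addrC.
Qed.

Lemma uniq_cyl_nbrs a : uniq (cyl_nbrs a).
Proof.
case: a => g u; rewrite /cyl_nbrs /= !inE xpair_eqE eqxx /=.
have ne (c : int) : c != 0 ->
    (g, u + c) \notin [seq (g', u) | g' <- enum (adj g)].
  move=> c0; apply/mapP => -[k _ [_ /eqP]].
  by rewrite -subr_eq0 addrAC subrr add0r (negbTE c0).
rewrite negb_or !ne // (inj_eq (addrI u)) /=.
by rewrite map_inj_uniq ?enum_uniq // => ? ? [].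
Qed.

Definition reach (S : seq (G * int)) (a b : G * int) : Prop :=
  exists p : seq (G * int),
    [/\ path cyl_adj a p, last a p = b & all (fun y => y \notin S) (a :: p)].

Definition is_component (S : seq (G * int)) (C : set (G * int)) : Prop :=
  exists a, a \notin S /\ C = [set b | reach S a b].

(* Finite subsets of the cylinder are represented by sequences. *)
Definition disconnects (S : seq (G * int)) : Prop :=
  exists M0 : int, forall M : int, M0 <= M ->
    exists C1 C2 : set (G * int),
      [/\ is_component S C1, is_component S C2, C1 <> C2,
          [set a | M <= a.2] `<=` C1 & [set a | a.2 <= - M] `<=` C2].

End Cylinder.

Section Walk.
Variables (R : realType) (G : sgraph).

Definition step (a b : G * int) : R :=
  if cyl_adj a b then (size (cyl_nbrs a))%:R^-1 else 0.

(* [X] is, under [P], a simple random walk started at [x]: since the state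
   space is countable, measurability and the Markov property are expressed on
   points and on finite trajectories. *)
Definition is_srw d (Omega : measurableType d) (P : probability Omega R)
    (X : nat -> Omega -> G * int) (x : G * int) : Prop :=
  [/\ forall n y, measurable [set w | X n w = y],
      P [set w | X 0%N w = x] = 1%E
    & forall (n : nat) (p : nat -> G * int),
        P [set w | forall k, (k <= n.+1)%N -> X k w = p k] =
        (P [set w | forall k, (k <= n)%N -> X k w = p k] *
         (step (p n) (p n.+1))%:E)%E].

(* Valued in the extended reals, so that the infimum of the empty set is +oo. *)
Definition disconnection_time (Omega : Type) (X : nat -> Omega -> G * int)
    (w : Omega) : \bar R :=
  ereal_inf [set n%:R%:E | n in
    [set n : nat | disconnects [seq X k w | k <- iota 0 n.+1]]].

End Walk.

(* Main.v *)
(** Disconnection by time [T = |G| ^ (2 (1 - delta))] is unlikely for two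
    opposite reasons.

    Small spectral gap [l].  A disconnecting trajectory meets every column
    [{g} x Z], so its projection on [G] visits both the maximum and the minimum
    of an eigenfunction [f] of the Laplacian for [l].  If it visits the maximum
    first, it must afterwards enter [{f <= 0}]; but as long as it stays in
    [{f > 0}], [f] shrinks in mean by a factor at least [1 - l] per step, so this
    has probability at most [1 - (1 - l) ^ T <= T l].  The other order is
    symmetric, hence the bound [2 T l <= 2 / log |G|].

    Large spectral gap [l].  Let [C] be the upper component of the complement of
    a disconnecting set [S].  Its horizontal slices grow from the empty set to
    [G]; either one of them has between [|G| / 2] and [3 |G| / 4] points, and the
    isoperimetric inequality given by [l] makes the same slice of [S] have at
    least [l |G| / (8 d0)] points, or the slices jump over this window and a
    slice of [S] has at least [|G| / 4] points.  So some height is visited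
    about [|G| ^ (1 - delta / 10)] times, whereas local times at time [T] have
    exponential tails at the scale [sqrt T = |G| ^ (1 - delta)]; a union bound
    over the heights within reach concludes. *)
Require Import Defs.
From mathcomp Require Import all_boot all_order all_algebra.
From mathcomp Require Import all_classical all_reals all_analysis.
From mathcomp Require Import ring lra zify.
Import Order.TTheory GRing.Theory Num.Theory.
Import numFieldNormedType.Exports.
Set Implicit Arguments.
Unset Strict Implicit.
Unset Printing Implicit Defensive.
Local Open Scope classical_set_scope.
Local Open Scope ring_scope.

(** * Expectations over finite stretches of the walk, computed by first-step recursion *)

Section WalkMean.
Context {R : realType} {G : sgraph}.
Implicit Types (x y : G * int) (h : G * int -> R) (F : seq (G * int) -> R).

Lemma size_cyl_nbrs x : size (cyl_nbrs x) = (vdeg x.1).+2.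
Proof. by rewrite /cyl_nbrs /= size_map -cardE. Qed.

Definition cyl_avg h x : R :=
  (size (cyl_nbrs x))%:R^-1 * \sum_(y <- cyl_nbrs x) h y.

Lemma le_cyl_avg h h' x :
  (forall y, cyl_adj x y -> h y <= h' y) -> cyl_avg h x <= cyl_avg h' x.
Proof.
move=> hh; rewrite /cyl_avg ler_wpM2l ?invr_ge0 ?ler0n // !big_seq.
by apply: ler_sum => y; rewrite mem_cyl_nbrs => /hh.
Qed.

Lemma cyl_avgD h h' x :
  cyl_avg (fun y => h y + h' y) x = cyl_avg h x + cyl_avg h' x.
Proof. by rewrite /cyl_avg big_split mulrDr. Qed.

Lemma cyl_avgZ c h x : cyl_avg (fun y => c * h y) x = c * cyl_avg h x.
Proof. by rewrite /cyl_avg -big_distrr /= mulrCA. Qed.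

Lemma cyl_avg_cst c x : cyl_avg (fun=> c) x = c.
Proof.
rewrite /cyl_avg big_const_seq count_predT iter_addr_0 size_cyl_nbrs.
by rewrite -[c *+ _]mulr_natl mulrA mulVf ?mul1r // pnatr_eq0.
Qed.

Lemma eq_cyl_avg h h' x : h =1 h' -> cyl_avg h x = cyl_avg h' x.
Proof. by move=> hh; rewrite /cyl_avg; congr (_ * _); apply: eq_bigr. Qed.

(* The expectation of [F (X_0, ..., X_m)] under [P_x]. *)
Fixpoint walk_mean m F x : R :=
  if m is m'.+1 then cyl_avg (walk_mean m' (fun p => F (x :: p))) x
  else F [:: x].

(** The functionals are compared along nearest-neighbor paths only, so that geometric facts such as
    [height_range] can be used under the mean. *)
Lemma le_walk_mean m F F' x :
  (forall p, path (@cyl_adj G) x p -> size p = m -> F (x :: p) <= F' (x :: p)) ->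
  walk_mean m F x <= walk_mean m F' x.
Proof.
elim: m F F' x => [|m IH] F F' x FF /=; first exact: FF.
apply: le_cyl_avg => y xy; apply: IH => p yp sp.
by apply: FF => /=; rewrite ?xy ?sp.
Qed.

Lemma eq_walk_mean m F F' x : F =1 F' -> walk_mean m F x = walk_mean m F' x.
Proof.
by move=> FF; apply/eqP; rewrite eq_le !le_walk_mean // => p *; rewrite FF.
Qed.

Lemma walk_meanD m F F' x :
  walk_mean m (fun p => F p + F' p) x = walk_mean m F x + walk_mean m F' x.
Proof.
elim: m F F' x => [|m IH] F F' x //=; rewrite -cyl_avgD.
by apply: eq_cyl_avg => y; rewrite IH.
Qed.

Lemma walk_meanZ m c F x : walk_mean m (fun p => c * F p) x = c * walk_mean m F x.
Proof.
elim: m F x => [|m IH] F x //=; rewrite -cyl_avgZ.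
by apply: eq_cyl_avg => y; rewrite IH.
Qed.

Lemma walk_mean_cst m c x : walk_mean m (fun=> c) x = c.
Proof.
elim: m x => [|m IH] x //=; rewrite -[RHS](cyl_avg_cst c x).
by apply: eq_cyl_avg => y; rewrite IH.
Qed.

Lemma walk_mean_sum m (I : Type) (r : seq I) (Fs : I -> seq (G * int) -> R) x :
  walk_mean m (fun p => \sum_(i <- r) Fs i p) x =
  \sum_(i <- r) walk_mean m (Fs i) x.
Proof.
elim: r => [|i r IH].
  by rewrite big_nil -[RHS](walk_mean_cst m 0 x); apply: eq_walk_mean => p; rewrite big_nil.
rewrite big_cons -IH -walk_meanD.
by apply: eq_walk_mean => p; rewrite big_cons.
Qed.

End WalkMean.

(** * Exponential tails of the local times of the height *)

Section LocalTime.
Context {R : realType} {G : sgraph}.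
Implicit Types (a : R) (x y : G * int) (z : int) (p : seq (G * int)).

Definition local_time z p : nat := count (fun y => y.2 == z) p.

Lemma cyl_avg_height (h : int -> R) x :
  cyl_avg (fun y => h y.2) x =
  (vdeg x.1).+2%:R^-1 * (h (x.2 + 1) + h (x.2 - 1) + (vdeg x.1)%:R * h x.2).
Proof.
rewrite /cyl_avg size_cyl_nbrs; congr (_ * _).
rewrite /cyl_nbrs !big_cons big_map /= addrA; congr (_ + _).
rewrite big_const_seq count_predT iter_addr_0 -cardE.
by rewrite -[in LHS]mulr_natl.
Qed.

(* [y |-> profile (1 - a) (y.2 - z)] is superharmonic up to a factor [1 + a ^ 2],
   with a kink at height [z] that pays for the factor
   [1 + a / (d + 2)] collected at each visit of that height. *)
Definition profile (s : R) (r : int) : R := 1 + s ^+ `|r|%N.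

Definition visit_weight (d : nat) (a : R) : R := 1 + a / d.+2%:R.

Lemma visit_weight_ge1 d a : 0 <= a -> 1 <= visit_weight d a.
Proof. by move=> a0; rewrite lerDl divr_ge0. Qed.

Lemma visit_weight_le2 d a : a <= 1 -> visit_weight d a <= 2.
Proof.
move=> a1; rewrite /visit_weight -[2]/(1 + 1 : R) lerD2l ler_pdivrMr ?ltr0n//.
by rewrite mul1r (le_trans a1)// ler1n.
Qed.

Lemma profile_ge1 a r : a <= 1 -> 1 <= profile (1 - a) r.
Proof. by move=> a1; rewrite lerDl exprn_ge0 // subr_ge0. Qed.

Lemma profile_le2 a r : 0 <= a <= 1 -> profile (1 - a) r <= 2.
Proof.
move=> /andP[a0 a1]; rewrite /profile -[2]/(1 + 1 : R) lerD2l exprn_ile1 //.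
  by rewrite subr_ge0.
by rewrite gerBl.
Qed.

(** Let [D] be the degree of [x.1]. At height [z] the average is [2 - 2 a / (D + 2)], and this
    deficit pays for the visit weight since [D <= d]. Elsewhere the second difference of the profile
    is [a ^ 2] times a power of [1 - a], which the factor [1 + a ^ 2] absorbs. *)
Lemma cyl_avg_profile d a z x : (vdeg x.1 <= d)%N -> 0 <= a <= 1 ->
  visit_weight d a ^+ (x.2 == z) * cyl_avg (fun y => profile (1 - a) (y.2 - z)) x
  <= (1 + a ^+ 2) * profile (1 - a) (x.2 - z).
Proof.
move=> dx /andP[a0 a1].
rewrite (cyl_avg_height (fun u => profile (1 - a) (u - z))).
set D := vdeg x.1 in dx *; have D0 : (0 : R) <= D%:R by rewrite ler0n.
have D2 : D.+2%:R = D%:R + 2 :> R by rewrite -addn2 natrD.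
have D2p : (0 : R) < D%:R + 2 by lra.
rewrite D2; case: eqVneq => [->|xz].
  rewrite [z + 1 - z]addrAC subrr add0r [z - 1]addrC addrK.
  rewrite /profile absz0 absz1 expr0 !expr1.
  rewrite -(ler_pM2l D2p) mulrCA mulVKf ?gt_eqF//.
  rewrite /visit_weight -[d.+2]addn2 natrD.
  have dD : D%:R <= d%:R :> R by rewrite ler_nat.
  have d2p : (0 : R) < d%:R + 2 by lra.
  set c := a / _; have c0 : 0 <= c by rewrite divr_ge0 // ltW.
  have : c * (D%:R + 2) <= a.
    by rewrite /c mulrAC ler_pdivrMr // ler_wpM2l // lerD2r.
  nra.
rewrite expr0 mul1r -(ler_pM2l D2p) mulVKf ?gt_eqF//.
rewrite [x.2 + 1 - z]addrAC [x.2 - 1 - z]addrAC.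
have : x.2 - z != 0 by rewrite subr_eq0.
move: (x.2 - z) => r r0.
(* The two vertical neighbors lie at distances [k] and [k + 2] from height [z], in an order that
   depends on the sign of [r]. *)
have [k [kr kE]] : exists k : nat, `|r|%N = k.+1 /\
    profile (1 - a) (r + 1) + profile (1 - a) (r - 1) =
    2 + (1 - a) ^+ k * (1 + (1 - a) ^+ 2).
  have [k [kr ks]] : exists k : nat, `|r|%N = k.+1 /\
     ((`|(r + 1)%R|%N = k.+2 /\ `|(r - 1)%R|%N = k) \/
      (`|(r - 1)%R|%N = k.+2 /\ `|(r + 1)%R|%N = k)).
    by exists (`|r|%N).-1; lia.
  exists k; split => //.
  by case: ks => -[e1 e2]; rewrite /profile e1 e2 -addn2 exprD; ring.
rewrite kE /profile kr (exprS _ k).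
pose s : R := (1 - a) ^+ k; rewrite -/s.
have s0 : 0 <= s by rewrite exprn_ge0 // subr_ge0.
have s1 : s <= 1 by rewrite exprn_ile1 ?subr_ge0// gerBl.
have t0 : 0 <= (1 - a) * s by rewrite mulr_ge0// subr_ge0.
have a2 : 0 <= a ^+ 2 by rewrite exprn_ge0.
have : a ^+ 2 * s <= a ^+ 2 * ((1 + (1 - a) * s) * (D%:R + 2)).
  rewrite ler_wpM2l //; nra.
lra.
Qed.

(** Each step costs one application of [cyl_avg_profile]. The leading 2 pays for a visit at the
    final time, as the weight is at most 2 and the profile at least 1. *)
Lemma walk_mean_local_time m d a z x :
  (max_deg G <= d)%N -> 0 <= a <= 1 ->
  walk_mean m (fun p => visit_weight d a ^+ local_time z p) x
  <= 2 * (1 + a ^+ 2) ^+ m * profile (1 - a) (x.2 - z).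
Proof.
move=> Gd a01; have /andP[a0 a1] := a01.
have w1 := visit_weight_ge1 d a0.
have a2 : 0 <= 1 + a ^+ 2 by rewrite addr_ge0 // exprn_ge0.
elim: m x => [|m IH] x.
  rewrite /= /local_time /= addn0 expr0 mulr1.
  have w2 := visit_weight_le2 d a1.
  have := profile_ge1 (x.2 - z) a1.
  by case: (x.2 == z); rewrite ?expr0 ?expr1; lra.
have xd : (vdeg x.1 <= d)%N by apply: leq_trans Gd; apply: leq_bigmax.
rewrite [X in X <= _](_ : _ = visit_weight d a ^+ (x.2 == z) *
    cyl_avg (walk_mean m (fun p => visit_weight d a ^+ local_time z p)) x).
  have c0 : 0 <= 2 * (1 + a ^+ 2) ^+ m by rewrite mulr_ge0 ?exprn_ge0.
  rewrite exprSr mulrA -mulrA.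
  apply: le_trans (ler_wpM2l c0 (cyl_avg_profile z xd a01)).
  rewrite [X in _ <= X]mulrCA -[X in _ <= _ * X]cyl_avgZ.
  rewrite ler_wpM2l ?exprn_ge0 ?(le_trans ler01)//.
  exact: le_cyl_avg.
rewrite /= -cyl_avgZ; apply: eq_cyl_avg => y.
by rewrite -walk_meanZ; apply: eq_walk_mean => p; rewrite /local_time /= exprD.
Qed.

(** Markov's inequality for the exponential moment; 4 is the leading 2 of that moment times the
    bound 2 on the profile. *)
Lemma local_time_tail m d a z L x :
  (max_deg G <= d)%N -> 0 <= a <= 1 ->
  walk_mean m (fun p => (L <= local_time z p)%N%:R) x
  <= 4 * (1 + a ^+ 2) ^+ m / visit_weight d a ^+ L.
Proof.
move=> Gd a01; have /andP[a0 a1] := a01.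
have w1 := visit_weight_ge1 d a0.
have w0 : 0 < visit_weight d a by rewrite (lt_le_trans ltr01).
rewrite ler_pdivlMr ?exprn_gt0 // mulrC -walk_meanZ.
apply: (@le_trans _ _ (walk_mean m
    (fun p => visit_weight d a ^+ local_time z p) x)).
  apply: le_walk_mean => p _ _; case: leqP => [Lp|_]; last first.
    by rewrite mulr0 exprn_ge0 // ltW.
  by rewrite mulr1 ler_weXn2l.
apply: le_trans (walk_mean_local_time _ _ _ Gd a01) _.
have := profile_le2 (x.2 - z) a01.
have : 0 <= (1 + a ^+ 2) ^+ m by rewrite exprn_ge0 ?addr_ge0 ?exprn_ge0.
nra.
Qed.

Lemma height_range x p y : path (@cyl_adj G) x p -> y \in x :: p ->
  `|y.2 - x.2| <= (size p)%:Z.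
Proof.
elim: p x => [|x' p IH] x /=; first by rewrite inE => _ /eqP ->; rewrite subrr.
case/andP => xx' px'; rewrite inE => /orP[/eqP->|/(IH _ px')].
  by rewrite subrr normr0.
case/orP: xx' => /andP[]; first by move=> _ /eqP; lia.
by move=> /eqP ->; lia.
Qed.

(** Union bound: a height with positive local time is within [m] of the starting one, which leaves
    [m.*2.+1] candidates. *)
Lemma max_local_time_tail m d a L x :
  (max_deg G <= d)%N -> 0 <= a <= 1 -> (0 < L)%N ->
  walk_mean m (fun p => `[< exists z, (L <= local_time z p)%N >]%:R) x
  <= (m.*2.+1)%:R * (4 * (1 + a ^+ 2) ^+ m / visit_weight d a ^+ L).
Proof.
move=> Gd a01 L0.
apply: (@le_trans _ _ (walk_mean m (fun p => \sum_(i <- iota 0 m.*2.+1)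
    (L <= local_time (x.2 - m%:Z + i%:Z) p)%N%:R) x)).
  apply: le_walk_mean => p xp sp; case: asboolP => [[z Lz]|_]; last first.
    by rewrite sumr_ge0.
  have : has (fun y => y.2 == z) (x :: p) by rewrite has_count (leq_trans L0).
  case/hasP => y /(height_range xp); rewrite sp => yx /eqP yz.
  have im : `|(z - (x.2 - m%:Z))%R|%N \in iota 0 m.*2.+1.
    by rewrite mem_iota; lia.
  rewrite (big_rem _ im) /= (_ : x.2 - m%:Z + _ = z); last by lia.
  by rewrite Lz lerDl sumr_ge0.
rewrite walk_mean_sum.
apply: (@le_trans _ _ (\sum_(i <- iota 0 m.*2.+1)
    (4 * (1 + a ^+ 2) ^+ m / visit_weight d a ^+ L))).
  by apply: ler_sum => i _; apply: local_time_tail.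
by rewrite big_const_seq count_predT size_iota iter_addr_0 [in leRHS]mulr_natl.
Qed.

End LocalTime.

(** * The isoperimetric inequality given by the spectral gap *)

Section Isoperimetry.
Context {R : realType} {G : sgraph}.
Implicit Types (f : G -> R) (A B : {set G}).

Lemma dirichlet_ge0 f : 0 <= dirichlet f.
Proof.
rewrite mulr_ge0 ?invr_ge0 ?mulr_ge0 //; apply: sumr_ge0 => g _.
by apply: sumr_ge0 => g' _; rewrite sqr_ge0.
Qed.

Lemma uvar_ge0 f : 0 <= uvar f.
Proof.
by rewrite mulr_ge0 ?invr_ge0 //; apply: sumr_ge0 => g _; rewrite sqr_ge0.
Qed.

Lemma uvar_gt0 f : nonconstant f -> 0 < uvar f.
Proof.
move=> [g [g' gg']]; have n0 : (0 < #|G|)%N by apply/card_gt0P; exists g.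
rewrite /uvar mulr_gt0 ?invr_gt0 ?ltr0n // lt_def sumr_ge0 => [|h _]; last first.
  by rewrite sqr_ge0.
rewrite andbT; apply/eqP => /eqP; rewrite psumr_eq0 => [/allP f0|h _]; last first.
  by rewrite sqr_ge0.
have fE h : f h = umean f.
  have := f0 h (mem_index_enum h).
  by rewrite /= sqrf_eq0 subr_eq0 => /eqP.
by apply: gg'; rewrite !fE.
Qed.

Lemma uvarE f : (0 < #|G|)%N ->
  uvar f = #|G|%:R^-1 * \sum_g f g ^+ 2 - umean f ^+ 2.
Proof.
move=> n0; have nE : #|G|%:R != 0 :> R by rewrite pnatr_eq0 -lt0n.
rewrite /uvar (eq_bigr (fun g => (f g ^+ 2 - 2 * umean f * f g) + umean f ^+ 2)).
  rewrite big_split /= sumrB -mulr_sumr sumr_const.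
  have -> : \sum_g f g = #|G|%:R * umean f by rewrite mulVKf.
  by rewrite -[_ *+ #|_|]mulr_natl; field.
by move=> g _; ring.
Qed.

Lemma spectral_gap_le f : nonconstant f -> spectral_gap R G <= dirichlet f / uvar f.
Proof.
move=> fn; apply: ge_inf; last by exists f.
by exists 0 => _ [h _ <-]; rewrite divr_ge0 ?dirichlet_ge0 ?uvar_ge0.
Qed.

Lemma spectral_gap_ge0 : 0 <= spectral_gap R G.
Proof.
rewrite /spectral_gap; set E := [set _ | _ in _].
have [->|/set0P E0] := eqVneq E set0; first by rewrite inf0.
by apply: lb_le_inf => // _ [h _ <-]; rewrite divr_ge0 ?dirichlet_ge0 ?uvar_ge0.
Qed.

Lemma sum_vdeg_le d B : (max_deg G <= d)%N ->
  \sum_(g in B) (vdeg g)%:R <= (d * #|B|)%:R :> R.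
Proof.
move=> Gd; rewrite -natr_sum ler_nat mulnC -sum_nat_const leq_sum // => g _.
by apply: leq_trans Gd; apply: leq_bigmax.
Qed.

(** Every edge leaving [A] ends in [B]. Counting it in both orientations gives twice the sum of the
    degrees over [B], and this 2 cancels the one in [dirichlet]. *)
Lemma dirichlet_indicator_le d A B : (max_deg G <= d)%N ->
  (forall g g', g \in A -> g' \notin A -> adj g g' -> g' \in B) ->
  dirichlet (fun g => (g \in A)%:R : R) <= #|G|%:R^-1 * (d * #|B|)%:R.
Proof.
move=> Gd AB; rewrite /dirichlet invfM mulrAC mulrC ler_wpM2l ?invr_ge0//.
rewrite mulrC ler_pdivrMr //.
apply: (@le_trans _ _ (\sum_(g : G) \sum_(g' : G | adj g g')
    ((g' \in B)%:R + (g \in B)%:R))).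
  apply: ler_sum => g _; apply: ler_sum => g' gg'.
  case: (boolP (g \in A)) => gA; case: (boolP (g' \in A)) => g'A.
  - by rewrite subrr expr0n addr_ge0.
  - by rewrite (AB _ _ gA g'A gg') sub0r sqrrN expr1n lerDl.
  - by rewrite adj_sym in gg'; rewrite (AB _ _ g'A gA gg') subr0 expr1n lerDr.
  - by rewrite subrr expr0n addr_ge0.
have sumB : \sum_(g : G) \sum_(g' : G | adj g g') (g \in B)%:R
    = \sum_(g in B) (vdeg g)%:R :> R.
  rewrite [RHS]big_mkcond /=; apply: eq_bigr => g _; rewrite sumr_const.
  by case: (g \in B); rewrite ?mul0rn.
under eq_bigr do rewrite big_split /=.
rewrite big_split /= [X in X + _](_ : _ = \sum_(g in B) (vdeg g)%:R).
  by rewrite sumB; have := sum_vdeg_le B Gd; lra.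
rewrite -sumB (exchange_big_dep xpredT) //=; apply: eq_bigr => g _.
by apply: eq_bigl => g'; rewrite adj_sym.
Qed.

(** The indicator of [A] is the test function; with [n] the number of vertices, its variance is
    [|A| (n - |A|) / n ^ 2]. *)
Lemma spectral_gap_isoperimetry d A B : (max_deg G <= d)%N ->
  (forall g g', g \in A -> g' \notin A -> adj g g' -> g' \in B) ->
  A != finset.set0 -> A != [set: G]%SET ->
  spectral_gap R G * (#|A|%:R * (#|G|%:R - #|A|%:R)) <= #|G|%:R * (d * #|B|)%:R.
Proof.
move=> Gd AB /set0Pn[g gA] AT.
have [g' _ g'A] : exists2 g', g' \in [set: G]%SET & g' \notin A.
  by apply/subsetPn; rewrite finset.subTset.
pose f h : R := (h \in A)%:R.
have fn : nonconstant f.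
  by exists g, g'; rewrite /f gA (negbTE g'A); apply/eqP; rewrite oner_eq0.
have n0 : (0 < #|G|)%N by apply/card_gt0P; exists g.
have nR : (0 : R) < #|G|%:R by rewrite ltr0n.
have sA : \sum_h f h = #|A|%:R.
  by rewrite /f -natr_sum -big_mkcond /= sum1_card.
have vE : uvar f * #|G|%:R ^+ 2 = #|A|%:R * (#|G|%:R - #|A|%:R).
  rewrite uvarE // (eq_bigr f) => [|h _]; last first.
    by rewrite /f; case: (h \in A); rewrite ?expr1n ?expr0n.
  by rewrite /umean sA; field; rewrite gt_eqF.
have := spectral_gap_le fn; rewrite ler_pdivlMr ?uvar_gt0 // => le1.
have := le_trans le1 (dirichlet_indicator_le Gd AB).
rewrite -vE mulrA => le2.
apply: le_trans (ler_wpM2r (exprn_ge0 2 (ltW nR)) le2) _.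
by rewrite mulrAC expr2 mulKf ?gt_eqF // mulrC.
Qed.

End Isoperimetry.

(** * A disconnecting set has a large horizontal slice *)

Section Separation.
Context {R : realType} {G : sgraph}.
Implicit Types (S : seq (G * int)) (z : int).

Lemma cyl_adj_sym : symmetric (@cyl_adj G).
Proof.
move=> a b; rewrite /cyl_adj eq_sym distrC [a.2 == _]eq_sym.
by rewrite [adj a.1 _]adj_sym.
Qed.

Lemma reach_trans S a b c : reach S a b -> reach S b c -> reach S a c.
Proof.
move=> [p [pp pl pa]] [q [qp ql qa]]; exists (p ++ q); split.
- by rewrite cat_path pp pl.
- by rewrite last_cat pl.
- by rewrite -cat_cons all_cat pa /=; case/andP: qa.
Qed.

Lemma reach_step S a b : cyl_adj a b -> a \notin S -> b \notin S -> reach S a b.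
Proof. by move=> ab aS bS; exists [:: b]; rewrite /= ab aS bS. Qed.

Lemma reach_sym S a b : reach S a b -> reach S b a.
Proof.
move=> [p []]; elim: p a => [|c p IH] a /=.
  by move=> _ -> aS; exists [::].
move=> /andP[ac cp] pl /and3P[aS cS pS].
apply: reach_trans (IH c cp pl _) _; first by rewrite /= cS.
by apply: reach_step => //; rewrite cyl_adj_sym.
Qed.

Lemma reach_notin S a b : reach S a b -> b \notin S.
Proof. by move=> /reach_sym [p [_ _ /andP[]]]. Qed.

Definition slice S z : {set G} := [set g | (g, z) \in S]%SET.

Lemma slice_local_time S z : (#|slice S z| <= local_time z S)%N.
Proof.
rewrite /local_time -size_filter cardE -(size_map (fun g => (g, z))).
apply: uniq_leq_size.
  by rewrite map_inj_uniq ?enum_uniq // => g g' [].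
by move=> _ /mapP[g + ->]; rewrite mem_enum inE mem_filter eqxx.
Qed.

Lemma disconnects_slice d S : (max_deg G <= d)%N -> (0 < #|G|)%N ->
  disconnects S -> exists z,
    spectral_gap R G * #|G|%:R <= (8 * d * #|slice S z|)%:R
    \/ (#|G| <= 4 * #|slice S z|)%N.
Proof.
move=> Gd n0 [M0 /(_ (Num.max M0 0))].
rewrite le_max lexx => /(_ isT)[C1 [C2 [[a [aS C1E]] [b [bS C2E]] C12]]].
set M := Num.max M0 0 => top bot.
have M_ge0 : 0 <= M by rewrite le_max lexx orbT.
have C1_step c c' : C1 c -> cyl_adj c c' -> c' \notin S -> C1 c'.
  rewrite C1E /= => ac cc' c'S.
  exact: reach_trans ac (reach_step cc' (reach_notin ac) c'S).
(* A common point would make the two components equal. *)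
have bot1 g : ~ C1 (g, - M).
  move=> c1; have c2 : C2 (g, - M) := bot (g, - M) (lexx _).
  apply: C12; move: c1 c2; rewrite C1E C2E /= => ac bc.
  apply/seteqP; split => c /=.
    by move=> ac'; apply: reach_trans bc (reach_trans (reach_sym ac) ac').
  by move=> bc'; apply: reach_trans ac (reach_trans (reach_sym bc) bc').
pose A z : {set G} := [set g | `[< C1 (g, z) >]]%SET.
have AP g z : reflect (C1 (g, z)) (g \in A z) by rewrite inE; apply: asboolP.
(* Heights are scanned upward from [- M], where the slice of [C1] is empty, to find the lowest one
   at which it fills at least half of [G]. *)
have ex_i : exists i : nat, (#|G| <= 2 * #|A (i%:Z - M)%R|)%N.
  exists `|(M + M)%R|%N; suff -> : A (`|(M + M)%R|%N%:Z - M) = [set: G]%SET.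
    by rewrite cardsT; lia.
  by apply/setP => g; rewrite [RHS]inE; apply/AP/(top (g, _)) => /=; lia.
case: (ex_minnP ex_i) => i; have [->|i0] := posnP i.
  rewrite (_ : A _ = finset.set0) ?cards0; first by lia.
  by apply/setP => g; rewrite [RHS]inE; apply/AP; rewrite sub0r; apply: bot1.
set z := i%:Z - M => Ai minA.
have {}minA : (2 * #|A (z - 1)%R| < #|G|)%N.
  rewrite ltnNge; apply/negP => le; have := minA i.-1.
  rewrite (_ : i.-1%:Z - M = z - 1); last by rewrite /z; lia.
  by move=> /(_ le); lia.
(* If the slice at [z] is not too full, isoperimetry applies to it; otherwise it has gained more
   than a quarter of [G] over the slice just below. *)
have [small|big] := leqP (4 * #|A z|) (3 * #|G|);
  [exists z; left|exists (z - 1); right].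
  have bd g g' : g \in A z -> g' \notin A z -> adj g g' -> g' \in slice S z.
    move=> /AP gA g'A gg'; rewrite inE; apply/negPn/negP => g'S.
    move/negP: g'A; apply; apply/AP/(C1_step _ _ gA) => //.
    by rewrite /cyl_adj /= eqxx gg' orbT.
  have A0 : A z != finset.set0 by rewrite -card_gt0; lia.
  have AT : A z != [set: G]%SET.
    by apply/eqP => E; move: small; rewrite E cardsT; lia.
  have := @spectral_gap_isoperimetry R G d _ _ Gd bd A0 AT.
  have nR : (0 : R) < #|G|%:R by rewrite ltr0n.
  have k1 : #|G|%:R <= 2 * #|A z|%:R :> R by rewrite -natrM ler_nat.
  have k2 : 4 * #|A z|%:R <= 3 * #|G|%:R :> R by rewrite -!natrM ler_nat.
  have l0 := @spectral_gap_ge0 R G.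
  move=> h; rewrite -mulnA [(8 * _)%:R]natrM; move: l0 nR k1 k2 h.
  move: (spectral_gap R G) (#|A z|%:R : R) (#|G|%:R : R).
  move: ((d * #|slice S z|)%N%:R : R) => s l k n l0 n_gt0 k1 k2 h.
  (* For [k] between [n / 2] and [3 n / 4], [k (n - k)] is at least [3 n ^ 2 / 16]. *)
  have kn : n * n <= 8 * (k * (n - k)) by nra.
  rewrite -(ler_pM2l n_gt0) mulrCA; apply: le_trans (ler_wpM2l l0 kn) _.
  by rewrite mulrCA [leRHS]mulrCA ler_pM2l.
(* A point of the upper component extends it one step down unless the point below belongs to [S]. *)
have AS : A z \subset A (z - 1) :|: slice S (z - 1).
  apply/fintype.subsetP => g gA; rewrite finset.in_setU; apply/orP.
  have [gS|gS] := boolP (g \in slice S (z - 1)); [by right|left].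
  apply/AP; apply: (C1_step _ _ (elimT (AP _ _) gA)); last by rewrite inE in gS.
  by rewrite /cyl_adj /= eqxx opprB addrC subrK normr1.
by have := leq_trans (subset_leq_card AS) (leq_card_setU _ _); lia.
Qed.

End Separation.

(** * Existence of an eigenfunction for the spectral gap *)

Section Eigenfunction.
Context {R : realType} {G : sgraph}.
Implicit Types f h : G -> R.

(** Not divided by the degree, to match the uniform measure behind [dirichlet] and [uvar]; with this
    sign the operator is nonpositive. *)
Definition laplacian f (g : G) : R := \sum_(g' : G | adj g g') (f g' - f g).

Definition dform f h : R :=
  (2 * #|G|%:R)^-1 * \sum_(g : G) \sum_(g' : G | adj g g')
    (f g' - f g) * (h g' - h g).

Lemma dirichletD f h t :
  dirichlet (fun g => f g + t * h g)
  = dirichlet f + 2 * t * dform f h + t ^+ 2 * dirichlet h.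
Proof.
rewrite /dirichlet /dform [2 * t * _]mulrCA [t ^+ 2 * _]mulrCA -!mulrDr.
congr (_ * _); rewrite !mulr_sumr -!big_split /=; apply: eq_bigr => g _.
by rewrite !mulr_sumr -!big_split /=; apply: eq_bigr => g' _; ring.
Qed.

(** Summation by parts: exchanging the endpoints of the edges turns the terms in [h g'] into the
    opposite of those in [h g]. *)
Lemma dform_laplacian f h :
  dform f h = - (#|G|%:R^-1 * \sum_(g : G) laplacian f g * h g).
Proof.
have [n0|n0] := posnP #|G|; first by rewrite /dform n0 mulr0 !invr0 !mul0r oppr0.
rewrite /dform.
have -> : \sum_(g : G) \sum_(g' : G | adj g g') (f g' - f g) * (h g' - h g)
    = - 2 * \sum_(g : G) laplacian f g * h g.
  have lE : \sum_(g : G) laplacian f g * h g =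
      \sum_(g : G) \sum_(g' : G | adj g g') (f g' - f g) * h g.
    by apply: eq_bigr => g _; rewrite mulr_suml.
  transitivity (\sum_(g : G) \sum_(g' : G | adj g g') (f g' - f g) * h g'
      - \sum_(g : G) \sum_(g' : G | adj g g') (f g' - f g) * h g).
    rewrite -sumrB; apply: eq_bigr => g _.
    by rewrite -sumrB; apply: eq_bigr => g' _; rewrite mulrBr.
  rewrite -lE [X in X - _](_ : _ = - \sum_(g : G) laplacian f g * h g).
    by ring.
  rewrite lE (exchange_big_dep xpredT) //= -sumrN; apply: eq_bigr => g _.
  rewrite -sumrN; apply: eq_big => [g'|g' _]; first by rewrite adj_sym.
  by rewrite -mulNr opprB.
by field; rewrite pnatr_eq0 -lt0n.
Qed.

Lemma uvarD f h t : umean f = 0 ->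
  uvar (fun g => f g + t * h g)
  = uvar f + 2 * t * (#|G|%:R^-1 * \sum_g f g * h g) + t ^+ 2 * uvar h.
Proof.
have [n0 _|n0 f0] := posnP #|G|.
  by rewrite /uvar n0 invr0 !mul0r !mulr0 !addr0.
rewrite !uvarE //.
have -> : umean (fun g => f g + t * h g) = t * umean h.
  by rewrite /umean big_split /= mulrDr [X in X + _]f0 add0r -mulr_sumr mulrCA.
have -> : \sum_g (f g + t * h g) ^+ 2 = \sum_g f g ^+ 2
    + 2 * t * (\sum_g f g * h g) + t ^+ 2 * \sum_g h g ^+ 2.
  by rewrite !mulr_sumr -!big_split /=; apply: eq_bigr => g _; ring.
by rewrite f0; ring.
Qed.

Lemma poincare f : (0 < #|G|)%N -> spectral_gap R G * uvar f <= dirichlet f.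
Proof.
move=> n0; have [fn|fc] := pselect (nonconstant f).
  by rewrite -ler_pdivlMr ?uvar_gt0 ?spectral_gap_le.
have [g0 _] := card_gt0P n0.
have fE g : f g = f g0 by apply: contrapT => gg; apply: fc; exists g, g0.
suff -> : uvar f = 0 by rewrite mulr0 dirichlet_ge0.
rewrite uvarE // /umean (eq_bigr (fun=> f g0 ^+ 2)) => [|g _]; last by rewrite fE.
rewrite [in X in _ - X](eq_bigr (fun=> f g0)) => [|g _]; last by rewrite fE.
rewrite !sumr_const -[f g0 *+ _]mulr_natl -[(_ ^+ 2) *+ _]mulr_natl.
by rewrite !mulKf ?subrr // pnatr_eq0 -lt0n.
Qed.

Lemma linear_coef_eq0 (b c : R) :
  (forall t : R, 0 <= t * b + t ^+ 2 * c) -> b = 0.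
Proof.
move=> H; apply/eqP/negPn/negP => b0.
have c0 : 0 < 1 + `|c| by rewrite ltr_pwDl.
(* At this [t] the linear term outweighs the quadratic one, since [1 + |c| > c]. *)
have := H (- b / (1 + `|c|)).
have -> : - b / (1 + `|c|) * b + (- b / (1 + `|c|)) ^+ 2 * c
   = - (b ^+ 2 / (1 + `|c|) ^+ 2) * (1 + `|c| - c).
  by field; rewrite gt_eqF.
apply/negP; rewrite -ltNge mulNr oppr_lt0 mulr_gt0 //.
  by rewrite divr_gt0 // exprn_even_gt0.
by have := ler_norm c; lra.
Qed.

(** First variation: [dirichlet] minus the gap times [uvar] is nonnegative and vanishes at [f], so
    its derivative in the direction of each point indicator is zero. *)
Lemma minimizer_eigenfunction f : (0 < #|G|)%N -> umean f = 0 ->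
  dirichlet f = spectral_gap R G * uvar f ->
  forall g, laplacian f g = - (spectral_gap R G * f g).
Proof.
move=> n0 f0 Df g.
have nR : #|G|%:R != 0 :> R by rewrite pnatr_eq0 -lt0n.
pose h (g' : G) : R := (g' == g)%:R.
have sum_h f' : \sum_g' f' g' * h g' = f' g.
  rewrite (bigD1 g) //= /h eqxx mulr1 big1 ?addr0 // => g' /negbTE ->.
  by rewrite mulr0.
have main t : 0 <= t * (2 * (dform f h - spectral_gap R G * (#|G|%:R^-1 * f g)))
    + t ^+ 2 * (dirichlet h - spectral_gap R G * uvar h).
  have := poincare (fun g => f g + t * h g) n0.
  by rewrite dirichletD uvarD // Df sum_h; lra.
have := linear_coef_eq0 main; rewrite dform_laplacian sum_h => /eqP.
rewrite mulf_eq0 pnatr_eq0 /= => /eqP E.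
have {}E : #|G|%:R^-1 * (laplacian f g + spectral_gap R G * f g) = 0 by lra.
by move/eqP: E; rewrite mulf_eq0 invr_eq0 (negbTE nR) /= addr_eq0 => /eqP ->.
Qed.

Lemma continuous_sumr (T : topologicalType) (I : Type) (r : seq I) (P : pred I)
    (F : I -> T -> R) :
  (forall i, P i -> continuous (F i)) ->
  continuous (fun x => \sum_(i <- r | P i) F i x).
Proof. by move=> Fc x; apply: cvg_big => [|i Pi]; [exact: add_continuous|exact: Fc]. Qed.

(** Functions on [G] are encoded as row vectors to inherit their topology and the compactness of
    boxes. *)
Definition row_fun (v : 'rV[R]_#|G|) (g : G) : R := v ord0 (enum_rank g).

Lemma row_fun_continuous g : continuous (row_fun^~ g).
Proof. exact: coord_continuous. Qed.

Lemma dirichlet_row_continuous : continuous (fun v => dirichlet (row_fun v)).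
Proof.
have sq g g' : continuous (fun v => (row_fun v g' - row_fun v g) ^+ 2).
  move=> v; rewrite (_ : (fun x => _) = (fun x => (row_fun x g' - row_fun x g) *
     (row_fun x g' - row_fun x g))); last by apply/funext => x; rewrite expr2.
  have dc : {for v, continuous (fun x => row_fun x g' - row_fun x g)}.
    by apply: continuousB; apply: row_fun_continuous.
  exact: (continuousM dc dc).
have inner g : continuous (fun v => \sum_(g' : G | adj g g')
    (row_fun v g' - row_fun v g) ^+ 2).
  exact: (continuous_sumr (fun g' _ => @sq g g')).
have outer := continuous_sumr (r := index_enum G) (P := xpredT) (fun g _ => inner g).
move=> v; have c0 : {for v, continuous (fun=> (2 * #|G|%:R)^-1 : R)}.
  exact: cst_continuous.
exact: (continuousM c0 (outer v)).
Qed.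

Definition unit_sphere : set 'rV[R]_#|G| :=
  [set v | \sum_g row_fun v g = 0 /\ \sum_g row_fun v g ^+ 2 = #|G|%:R].

Lemma unit_sphere_compact : compact unit_sphere.
Proof.
have boxc := rV_compact (fun i : 'I_#|G| =>
  @segment_compact R (- #|G|%:R) #|G|%:R).
apply: subclosed_compact boxc _; first apply: closedI.
- apply: (@preimage_closed _ _ (fun v => \sum_g row_fun v g) [set x | x = 0]).
    by move=> v _; exact: (continuous_sumr (fun g _ => @row_fun_continuous g)).
  exact: closed_eq.
- apply: (@preimage_closed _ _ (fun v => \sum_g row_fun v g ^+ 2)
      [set x | x = #|G|%:R]); last exact: closed_eq.
  have sq g : continuous (fun v => row_fun v g ^+ 2).
    move=> v; rewrite (_ : (fun x => _) = (fun x => row_fun x g * row_fun x g)).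
      exact: (continuousM (@row_fun_continuous g v) (@row_fun_continuous g v)).
    by apply/funext => x; rewrite expr2.
  by move=> v _; exact: (continuous_sumr (fun g _ => @sq g)).
(* Each squared coordinate is at most [#|G|], hence at most its square, so the sphere lies in the
   box. *)
- move=> v [_ v2] i /=; rewrite in_itv /= -ler_norml.
  have n1 : (1 : R) <= #|G|%:R.
    by rewrite ler1n; apply/card_gt0P; exists (enum_val i).
  rewrite -(ler_pXn2r (n := 2)) ?nnegrE // -normrX ger0_norm ?sqr_ge0 //.
  apply: (@le_trans _ _ #|G|%:R); last by rewrite expr2 ler_peMr.
  rewrite -v2 (bigD1 (enum_val i)) //= /row_fun enum_valK lerDl.
  by apply: sumr_ge0 => g _; rewrite sqr_ge0.
Qed.

Definition normalize f : 'rV[R]_#|G| :=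
  \row_i ((f (enum_val i) - umean f) / Num.sqrt (uvar f)).

Lemma row_fun_normalize f g :
  row_fun (normalize f) g = (f g - umean f) / Num.sqrt (uvar f).
Proof. by rewrite /row_fun mxE enum_rankK. Qed.

Lemma normalize_sphere f : nonconstant f -> unit_sphere (normalize f).
Proof.
move=> fn; have v0 := uvar_gt0 fn.
have n0 : (0 < #|G|)%N by case: fn => g _; apply/card_gt0P; exists g.
have nR : #|G|%:R != 0 :> R by rewrite pnatr_eq0 -lt0n.
split; under eq_bigr do rewrite row_fun_normalize.
  rewrite -mulr_suml sumrB sumr_const -[_ *+ _]mulr_natl /umean.
  by rewrite mulVKf // subrr mul0r.
under eq_bigr do rewrite exprMn exprVn sqr_sqrtr ?uvar_ge0 //.
rewrite -mulr_suml; move: v0; rewrite /uvar.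
set s := \sum_g _; case: (eqVneq s 0) => [->|s0 _]; first by rewrite mulr0 ltxx.
by rewrite invfM invrK mulrCA mulfV // mulr1.
Qed.

Lemma dirichlet_normalize f :
  dirichlet (row_fun (normalize f)) = dirichlet f / uvar f.
Proof.
rewrite /dirichlet -mulrA; congr (_ * _); rewrite mulr_suml.
apply: eq_bigr => g _; rewrite mulr_suml; apply: eq_bigr => g' _.
rewrite !row_fun_normalize -mulrBl exprMn exprVn sqr_sqrtr ?uvar_ge0 //.
by congr (_ ^+ 2 * _); ring.
Qed.

(** Centering and rescaling preserve the Rayleigh quotient, so its infimum is a minimum over a
    compact sphere; the minimizer is the eigenfunction. *)
Lemma spectral_gap_eigenfunction : (2 <= #|G|)%N ->
  exists f : G -> R, [/\ \sum_g f g = 0, exists g, f g != 0 &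
    forall g, laplacian f g = - (spectral_gap R G * f g)].
Proof.
move=> n2; have n0 : (0 < #|G|)%N by apply: leq_trans n2.
have nR : #|G|%:R != 0 :> R by rewrite pnatr_eq0 -lt0n.
have [g0 [g1 g01]] : exists g0 g1 : G, g0 != g1.
  have /card_gt1P[g0 [g1 [_ _ g01]]] : (1 < #|G|)%N by [].
  by exists g0, g1.
pose h (g : G) : R := (g == g0)%:R.
have hn : nonconstant h.
  exists g0, g1; rewrite /h eqxx eq_sym (negbTE g01).
  by apply/eqP; rewrite oner_eq0.
have [v vS vmin] := compact_EVT_min (ex_intro _ _ (normalize_sphere hn))
  unit_sphere_compact (continuous_subspaceT dirichlet_row_continuous).
move: vS; rewrite inE => -[v0 v2].
have mean0 : umean (row_fun v) = 0 by rewrite /umean v0 mulr0.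
have var1 : uvar (row_fun v) = 1.
  by rewrite uvarE // mean0 expr0n /= subr0 v2 mulVf.
exists (row_fun v); split => //.
  apply: contrapT => nex; have := v2; rewrite big1 => [|g _].
    by move/eqP; rewrite eq_sym (negbTE nR).
  have [->|vg] := eqVneq (row_fun v g) 0; first by rewrite expr0n.
  by case: nex; exists g.
apply: minimizer_eigenfunction => //; apply/eqP; rewrite eq_le poincare // andbT.
rewrite var1 mulr1; apply: lb_le_inf.
  by exists (dirichlet h / uvar h), h.
move=> _ [f fn <-]; rewrite -dirichlet_normalize; apply: vmin.
by rewrite inE; apply: normalize_sphere.
Qed.

End Eigenfunction.

(** * Covering all columns is unlikely when the gap is small *)

Section Covering.
Context {R : realType} {G : sgraph}.
Implicit Types (f : G -> R) (l : R) (x y : G * int) (p : seq (G * int)).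
Implicit Types (a b : pred (G * int)).

Lemma cyl_avg_base f x :
  cyl_avg (fun y => f y.1) x = f x.1 + (vdeg x.1).+2%:R^-1 * laplacian f x.1.
Proof.
rewrite /cyl_avg size_cyl_nbrs /cyl_nbrs !big_cons big_map big_enum /=.
rewrite /laplacian sumrB sumr_const -[f x.1 *+ _]mulr_natl -/(vdeg x.1).
rewrite -[(vdeg x.1).+2]addn2 natrD; field.
by rewrite -natrD pnatr_eq0 addn2.
Qed.

(* [f] is an eigenfunction of the Laplacian, so [f (X_k)] loses at most a factor
   [1 - l] in mean at each step taken in [{f > 0}]. *)
Lemma walk_mean_stay_pos f l M m x : 0 <= l <= 1 -> 0 < M ->
  (forall g, f g <= M) -> (forall g, laplacian f g = - (l * f g)) ->
  (1 - l) ^+ m * (f x.1 / M) <=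
    walk_mean m (fun p => (all (fun y => 0 < f y.1) p)%:R) x.
Proof.
move=> /andP[l0 l1] M0 fM fL; elim: m x => [|m IH] x.
  rewrite expr0 mul1r /= andbT; case: ltP => [_|fx].
    by rewrite ler_pdivrMr // mul1r.
  by rewrite pmulr_lle0 // invr_gt0.
have [fx|fx] := ltP 0 (f x.1); last first.
  apply: (@le_trans _ _ 0).
    by rewrite mulr_ge0_le0 ?exprn_ge0 ?subr_ge0 // pmulr_lle0 // invr_gt0.
  rewrite -(walk_mean_cst m.+1 0 x).
  by apply: le_walk_mean => p _ _.
rewrite [leRHS](_ : _ = cyl_avg (walk_mean m
    (fun p => (all (fun y => 0 < f y.1) p)%:R)) x); last first.
  by apply: eq_cyl_avg => y; apply: eq_walk_mean => p /=; rewrite fx.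
apply: le_trans (le_cyl_avg (fun y _ => IH y)); rewrite cyl_avgZ.
under [in leRHS]eq_cyl_avg do rewrite mulrC.
rewrite cyl_avgZ cyl_avg_base fL exprSr -mulrA ler_wpM2l ?exprn_ge0 ?subr_ge0 //.
rewrite [f x.1 / M]mulrC mulrCA ler_wpM2l ?invr_ge0 ?(ltW M0) //.
(* The actual decay rate is [l] divided by the number of neighbors in the cylinder, hence at most
   [l]. *)
rewrite mulrBl mul1r lerD2l mulrN lerN2 ler_piMl ?mulr_ge0 ?(ltW fx) //.
by rewrite invf_le1 ?ltr0n // ler1n.
Qed.

Lemma subr_expr_le l m : 0 <= l <= 1 -> 1 - (1 - l) ^+ m <= m%:R * l.
Proof.
move=> /andP[l0 l1]; elim: m => [|m IH]; first by rewrite expr0 subrr mul0r.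
have : (1 - l) ^+ m <= 1 by rewrite exprn_ile1 ?subr_ge0 // gerBl.
rewrite exprSr -natr1; nra.
Qed.

Lemma walk_mean_leave_pos f l g m x : 0 <= l <= 1 -> 0 < f g ->
  (forall g', f g' <= f g) -> (forall g', laplacian f g' = - (l * f g')) ->
  x.1 = g ->
  walk_mean m (fun p => (has (fun y => f y.1 <= 0) p)%:R) x <= m%:R * l.
Proof.
move=> l01 fg fmax fL xg; apply: le_trans (subr_expr_le m l01).
have := walk_mean_stay_pos m x l01 fg fmax fL.
rewrite xg divff ?gt_eqF // mulr1 lerBrDr => h.
apply: le_trans (lerD (lexx _) h) _; rewrite -walk_meanD.
rewrite -[leRHS](walk_mean_cst m 1 x); apply: le_walk_mean => p _ _.
move: (x :: p) => {}p /=.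
have -> : all (fun y => 0 < f y.1) p = ~~ has (fun y => f y.1 <= 0) p.
  by rewrite -all_predC; apply: eq_all => y /=; rewrite ltNge.
by case: has; rewrite ?addr0 ?add0r.
Qed.

(** Here [has b] inspects the whole of [p], current point included, so that it matches [walk_mean]
    started at that point. *)
Fixpoint visits_then a b p : bool :=
  if p is y :: p' then (a y && has b p) || visits_then a b p' else false.

Lemma visits_then_has a b p : visits_then a b p -> has b p.
Proof. by elim: p => //= y p IH /orP[/andP[]//|/IH ->]; rewrite orbT. Qed.

Lemma visits_then_total a b p :
  has a p -> has b p -> visits_then a b p || visits_then b a p.
Proof.
elim: p => //= y p IH ap bp; rewrite ap bp !andbT.
case: (a y) ap => //= ap; case: (b y) bp => //= bp; first by rewrite orbT.
exact: IH.
Qed.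

Lemma sub_visits_then a b b' p :
  subpred b b' -> visits_then a b p -> visits_then a b' p.
Proof.
move=> bb; elim: p => //= y p IH /orP[/andP[-> /= /orP[/bb|/(sub_has bb)] ->]|/IH ->].
- by [].
- by rewrite orbT.
- by rewrite orbT.
Qed.

(** Markov property at the first visit to [a]: with [k] steps left, the bound is [c k], and
    monotonicity of [c] replaces it by [c m]. *)
Lemma walk_mean_visits_then a b (c : nat -> R) m x :
  (forall k, 0 <= c k <= c k.+1) ->
  (forall k y, a y -> walk_mean k (fun p => (has b p)%:R) y <= c k) ->
  walk_mean m (fun p => (visits_then a b p)%:R) x <= c m.
Proof.
move=> c_incr H; elim: m x => [|m IH] x; case: (boolP (a x)) => ax.
- apply: le_trans (H 0%N x ax) => /=.
  by rewrite ax orbF.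
- by rewrite /= (negbTE ax) /=; case/andP: (c_incr 0%N).
- apply: le_trans (H m.+1 x ax); apply: le_walk_mean => p _ _.
  rewrite ler_nat; case: (boolP (visits_then _ _ _)) => // v.
  by rewrite (visits_then_has v).
- apply: (@le_trans _ _ (c m)); last by case/andP: (c_incr m).
  rewrite -[leRHS](cyl_avg_cst _ x); apply: le_cyl_avg => y _.
  apply: le_trans (IH y); apply: le_walk_mean => p _ _.
  by rewrite /= (negbTE ax).
Qed.

Definition covers p : bool := [forall g : G, has (fun y => y.1 == g) p].

Lemma walk_mean_covers m x : (2 <= #|G|)%N -> spectral_gap R G <= 1 ->
  walk_mean m (fun p => (covers p)%:R) x <= 2 * (m%:R * spectral_gap R G).
Proof.
move=> n2 l1; have l01 : 0 <= spectral_gap R G <= 1 by rewrite spectral_gap_ge0.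
have [f [f0 [g0 fg0] fL]] := spectral_gap_eigenfunction (R := R) n2.
have [g1 _ /(_ _ isT) g1max] := arg_maxP f (isT : xpredT g0).
have [g2 _ /(_ _ isT) g2min] := arg_minP f (isT : xpredT g0).
(* Applied to [f] and to [- f], this makes the maximum positive and the minimum negative. *)
have sgn (h : G -> R) : \sum_g h g = 0 -> h g0 != 0 -> exists g, 0 < h g.
  move=> h0 hg0; apply: contrapT => hn.
  have hN g : 0 <= - h g by rewrite oppr_ge0 leNgt; apply/negP => ?; apply: hn; exists g.
  have /eqP : \sum_g - h g = 0 by rewrite sumrN h0 oppr0.
  rewrite psumr_eq0 // => /allP/(_ g0 (mem_index_enum _)).
  by rewrite /= oppr_eq0 (negbTE hg0).
have fg1 : 0 < f g1 by have [g fg] := sgn f f0 fg0; apply: lt_le_trans (g1max g).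
have fg2 : 0 < - f g2.
  have [||g fg] := sgn (fun g => - f g); rewrite ?sumrN ?f0 ?oppr0 ?oppr_eq0 //.
  by apply: (lt_le_trans fg); rewrite lerN2.
pose c k : R := k%:R * spectral_gap R G.
have c_incr k : 0 <= c k <= c k.+1.
  by rewrite mulr_ge0 ?spectral_gap_ge0 //= ler_wpM2r ?spectral_gap_ge0 // ler_nat.
have b1 := walk_mean_visits_then (a := fun y => y.1 == g1)
  (b := fun y => f y.1 <= 0) m x c_incr _.
have b2 := walk_mean_visits_then (a := fun y => y.1 == g2)
  (b := fun y => - f y.1 <= 0) m x c_incr _.
apply: (@le_trans _ _ (c m + c m)); last by rewrite /c; lra.
apply: le_trans (lerD (b1 _) (b2 _)).
- rewrite -walk_meanD; apply: le_walk_mean => p _ _.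
  rewrite -natrD ler_nat; case: (boolP (covers _)) => // /forallP cov.
  have /orP[v|v] := visits_then_total (cov g1) (cov g2).
    rewrite (sub_visits_then _ v) // => y /= /eqP ->.
    by rewrite -oppr_ge0 ltW.
  rewrite [visits_then (fun y => y.1 == g2) _ _](sub_visits_then _ v) ?addn1 //.
  by move=> y /= /eqP ->; rewrite oppr_le0 ltW.
- move=> k y /eqP; apply: walk_mean_leave_pos => //.
- move=> k y /eqP; apply: (walk_mean_leave_pos (f := fun g => - f g)) => //.
    by move=> g; rewrite lerN2.
  move=> g; rewrite mulrN -fL /laplacian -sumrN.
  by apply: eq_bigr => g' _; rewrite opprB opprK addrC.
Qed.

(* An unvisited column joins the two ends of the cylinder. *)
Lemma disconnects_covers (S : seq (G * int)) : disconnects S -> covers S.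
Proof.
move=> [M0 /(_ (Num.max M0 0))].
rewrite le_max lexx => /(_ isT)[C1 [C2 [[a [aS C1E]] [b [bS C2E]] C12]]].
set M := Num.max M0 0 => top bot.
have M_ge0 : 0 <= M by rewrite le_max lexx orbT.
apply/forallP => g; apply/negPn/negP => /hasPn gS.
have col z : (g, z) \notin S by apply/negP => /gS; rewrite eqxx.
have up (k : nat) : reach S (g, - M) (g, - M + k%:Z).
  elim: k => [|k IH]; first by rewrite addr0; exists [::]; rewrite /= col.
  apply: reach_trans IH _; apply: reach_step => //.
  by rewrite /cyl_adj /= eqxx; apply/orP; left; apply/eqP; lia.
have {}up : reach S (g, - M) (g, M).
  by have := up `|(M + M)%R|%N; rewrite (_ : - M + _ = M) //; lia.
have c1 : C1 (g, M) := top (g, M) (lexx _).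
have c2 : C2 (g, - M) := bot (g, - M) (lexx _).
apply: C12; move: c1 c2; rewrite C1E C2E /= => ac bc.
have ab := reach_trans ac (reach_trans (reach_sym up) (reach_sym bc)).
by apply/seteqP; split => c /=; apply: reach_trans; [apply: reach_sym|].
Qed.

End Covering.

(** * From the probability space to finite averages over paths *)

Definition traj (G : sgraph) (Omega : Type) (X : nat -> Omega -> G * int) n w :
  seq (G * int) := [seq X k w | k <- iota 0 n.+1].

Lemma trajS (G : sgraph) (Omega : Type) (X : nat -> Omega -> G * int) n w :
  traj X n.+1 w = rcons (traj X n w) (X n.+1 w).
Proof. by rewrite /traj -[n.+2]addn1 iotaD map_cat cats1. Qed.

Section Trajectories.
Context {R : realType} {G : sgraph} {d : measure_display}.
Context {Omega : measurableType d} (P : probability Omega R).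
Context (X : nat -> Omega -> G * int) (x : G * int).
Hypothesis X_srw : is_srw P X x.
Local Notation traj := (traj X).
Implicit Types (E : set Omega) (A : set (seq (G * int))).

Lemma X_measurable n (B : set (G * int)) : measurable [set w | B (X n w)].
Proof.
have [mX _ _] := X_srw.
rewrite (_ : [set w | _] = \bigcup_y ([set w | X n w = y] `&` [set w | B y])).
  apply: countable_bigcupT_measurable => [|y]; first exact: countableP.
  apply: measurableI => //.
  have [By|By] := pselect (B y).
    by rewrite (_ : [set w | _] = setT) //; apply/seteqP; split.
  by rewrite (_ : [set w | _] = set0) //; apply/seteqP; split.
apply/seteqP; split => w /=; first by exists (X n w).
by case=> y _ [/= -> ].
Qed.

Lemma traj_measurable n A : measurable [set w | A (traj n w)].
Proof.
have [mX _ _] := X_srw.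
elim: n A => [|n IH] A; first exact: (X_measurable 0 (fun y => A [:: y])).
rewrite (_ : [set w | _] = \bigcup_y ([set w | X n.+1 w = y] `&`
    [set w | A (rcons (traj n w) y)])).
  apply: countable_bigcupT_measurable => [|y]; first exact: countableP.
  apply: measurableI => //.
  exact: (IH (fun s => A (rcons s y))).
apply/seteqP; split => w /=; rewrite trajS; first by exists (X n.+1 w).
by case=> y _ [/= -> ].
Qed.

Definition prob E : R := fine (P E).

Lemma probE E : measurable E -> P E = (prob E)%:E.
Proof. by move=> mE; rewrite /prob fineK // fin_num_measure. Qed.

Lemma prob_ge0 E : 0 <= prob E.
Proof. by rewrite fine_ge0 // measure_ge0. Qed.

Lemma le_prob E E' : measurable E -> measurable E' -> E `<=` E' -> prob E <= prob E'.
Proof. by move=> mE mE' EE'; rewrite -lee_fin -!probE // le_measure // inE. Qed.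

(** The leftover outside [r] stays explicit; it is shown to be null once [r] lists all possible
    positions. *)
Lemma prob_split n E (r : seq (G * int)) : measurable E -> uniq r ->
  prob E = prob (E `&` [set w | X n w \notin r])
           + \sum_(y <- r) prob (E `&` [set w | X n w = y]).
Proof.
move=> mE; elim: r => [_|y r IH /= /andP[yr ur]].
  by rewrite big_nil addr0; congr prob; apply/seteqP; split => w //= [].
rewrite big_cons addrA {}IH //; congr (_ + _).
have mN B := measurableI _ _ mE (X_measurable n B).
apply: EFin_inj; rewrite EFinD -!probE; [|exact: mN (fun z => z = y)|
  exact: mN (fun z => is_true (z \notin y :: r))|
  exact: mN (fun z => is_true (z \notin r))].
rewrite -measureU; [|exact: mN (fun z => is_true (z \notin y :: r))|
  exact: mN (fun z => z = y)|].
  congr (P _); apply/seteqP; split => w /=.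
    move=> [Ew Xr]; have [Xy|Xy] := eqVneq (X n w) y; [by right|left].
    by split => //; rewrite inE negb_or Xy.
  move=> [[Ew]|[Ew ->]]; last by split.
  by rewrite inE negb_or => /andP[_ Xr].
by apply/seteqP; split => w //= [[_ +] [_ Xy]]; rewrite Xy inE eqxx.
Qed.

Lemma trajP n s w : size s = n.+1 ->
  traj n w = s <-> forall k, (k <= n)%N -> X k w = nth x s k.
Proof.
move=> sn; have sz : size (traj n w) = n.+1 by rewrite size_map size_iota.
have nthE k : (k <= n)%N -> nth x (traj n w) k = X k w.
  by move=> kn; rewrite (nth_map 0%N) ?size_iota ?nth_iota.
split=> [<- k /nthE ->//|H]; apply: (@eq_from_nth _ x); rewrite ?sz ?sn // => k.
by rewrite ltnS => kn; rewrite nthE ?H.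
Qed.

Lemma prob_step n s a b :
  prob [set w | traj n.+1 w = rcons (rcons s a) b] =
  prob [set w | traj n w = rcons s a] * step R a b.
Proof.
have [_ _ /(_ n (nth x (rcons (rcons s a) b)))] := X_srw.
(* A prefix of the wrong length makes both events empty. *)
have [sn|sn] := eqVneq (size s) n; last first.
  have e0 k s' : size s' != k.+1 -> [set w | traj k w = s'] = set0.
    move=> sk; apply/seteqP; split => w //= E; move: sk.
    by rewrite -E size_map size_iota eqxx.
  by rewrite !e0 ?size_rcons // /prob measure0 mul0r.
have -> : [set w | forall k, (k <= n.+1)%N -> X k w = nth x (rcons (rcons s a) b) k]
    = [set w | traj n.+1 w = rcons (rcons s a) b].
  by apply/seteqP; split => w; move/(trajP w (s := rcons (rcons s a) b)) => /=;
    apply; rewrite !size_rcons sn.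
have -> : [set w | forall k, (k <= n)%N -> X k w = nth x (rcons (rcons s a) b) k]
    = [set w | traj n w = rcons s a].
  have nE k : (k <= n)%N -> nth x (rcons (rcons s a) b) k = nth x (rcons s a) k.
    by move=> kn; rewrite nth_rcons size_rcons sn ltnS kn.
  have tP w := @trajP n (rcons s a) w (etrans (size_rcons _ _) (congr1 S sn)).
  apply/seteqP; split => w /= H; first by apply: (proj2 (tP w)) => k kn; rewrite H ?nE.
  by move=> k kn; rewrite nE //; apply: (proj1 (tP w)).
rewrite !nth_rcons !size_rcons sn ltnn eqxx ltnS leqnn ltnn eqxx.
move=> E; apply: EFin_inj; rewrite EFinM -!probE //.
  exact: (traj_measurable n (eq^~ (rcons s a))).
exact: (traj_measurable n.+1 (eq^~ (rcons (rcons s a) b))).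
Qed.

(** Induction on the remaining time, splitting on the next position; [s] stores the past because [A]
    concerns the whole trajectory. *)
Lemma prob_prefix_le n m s a A :
  prob ([set w | traj n w = rcons s a] `&` [set w | A (traj (n + m) w)])
  <= prob [set w | traj n w = rcons s a]
     * walk_mean m (fun q => (`[< A (s ++ q) >])%:R) a.
Proof.
elim: m n s a => [|m IH] n s a.
  rewrite /= addn0 cats1; case: asboolP => As; rewrite ?mulr1 ?mulr0.
    apply: le_prob; first apply: measurableI.
    - exact: (traj_measurable n (eq^~ (rcons s a))).
    - exact: traj_measurable.
    - exact: (traj_measurable n (eq^~ (rcons s a))).
    - by move=> w [].
  rewrite (_ : _ `&` _ = set0) /prob ?measure0 //.
  by apply/seteqP; split => w //= [-> ].
set C := [set w | traj n w = _]; set E := C `&` _.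
have mC : measurable C := traj_measurable n (eq^~ (rcons s a)).
have mE : measurable E by apply: measurableI => //; exact: traj_measurable.
have CE y : C `&` [set w | X n.+1 w = y] =
    [set w | traj n.+1 w = rcons (rcons s a) y].
  apply/seteqP; split => w /=; rewrite trajS; first by case=> -> ->.
  by move=> /rcons_inj[].
have mN F B : measurable F -> measurable (F `&` [set w | B (X n.+1 w)]).
  by move=> mF; apply: measurableI => //; exact: X_measurable.
(* The transition probabilities to the neighbors already sum to 1. *)
have N0 : prob (C `&` [set w | X n.+1 w \notin cyl_nbrs a]) = 0.
  have := prob_split n.+1 mC (uniq_cyl_nbrs a).
  rewrite [X in _ = _ + X](_ : _ = prob C); first lra.
  under eq_bigr do rewrite CE prob_step.
  rewrite -mulr_sumr big_seq (eq_bigr (fun=> (size (cyl_nbrs a))%:R^-1)).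
    rewrite -big_seq big_const_seq count_predT iter_addr_0 size_cyl_nbrs.
    by rewrite -[_ *+ _]mulr_natl mulfV ?mulr1 // pnatr_eq0.
  by move=> y; rewrite mem_cyl_nbrs /step => ->.
rewrite (prob_split n.+1 mE (uniq_cyl_nbrs a)).
have -> : prob (E `&` [set w | X n.+1 w \notin cyl_nbrs a]) = 0.
  apply: le_anti; rewrite prob_ge0 andbT -N0; apply: le_prob.
  - exact: (mN E (fun z => is_true (z \notin cyl_nbrs a))).
  - exact: (mN C (fun z => is_true (z \notin cyl_nbrs a))).
  - by move=> w [[]].
rewrite add0r /= /cyl_avg mulrA mulr_sumr !big_seq; apply: ler_sum => y ya.
have -> : E `&` [set w | X n.+1 w = y] =
   [set w | traj n.+1 w = rcons (rcons s a) y] `&` [set w | A (traj (n.+1 + m) w)].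
  by rewrite -CE -setIA [X in C `&` X]setIC setIA addSnnS.
apply: le_trans (IH _ _ _) _.
rewrite prob_step /step -mem_cyl_nbrs ya.
rewrite ler_wpM2l ?mulr_ge0 ?prob_ge0 ?invr_ge0 //.
by apply: le_walk_mean => p _ _; rewrite cat_rcons.
Qed.

Lemma prob_traj_le m A :
  (P [set w | A (traj m w)] <= (walk_mean m (fun p => (`[< A p >])%:R) x)%:E)%E.
Proof.
have mA : measurable [set w | A (traj m w)] := traj_measurable m A.
have [_ X0 _] := X_srw; rewrite probE // lee_fin.
have prob1 : prob [set w | X 0%N w = x] = 1 by rewrite /prob X0.
have N0 : prob [set w | X 0%N w \notin [:: x]] = 0.
  have := @prob_split 0 setT [:: x] measurableT isT.
  by rewrite big_seq1 !setTI prob1 /prob probability_setT /=; lra.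
rewrite (@prob_split 0 _ [:: x]) // big_seq1.
have -> : prob ([set w | A (traj m w)] `&` [set w | X 0%N w \notin [:: x]]) = 0.
  apply: le_anti; rewrite prob_ge0 andbT -N0; apply: le_prob.
  - by apply: measurableI => //; exact: (X_measurable 0 (fun z => is_true (z \notin [:: x]))).
  - exact: (X_measurable 0 (fun z => is_true (z \notin [:: x]))).
  - by move=> w [].
rewrite add0r setIC.
have E0 : [set w | X 0%N w = x] = [set w | traj 0 w = rcons [::] x].
  by apply/seteqP; split => w /=; [rewrite /traj /= => ->|case].
rewrite E0; apply: le_trans (prob_prefix_le 0 m [::] x A) _.
by rewrite -E0 prob1 mul1r.
Qed.

End Trajectories.

(** * Two bounds on the probability of early disconnection *)

Section Assembly.
Context {R : realType}.

(** The time is an infimum of integers: if none up to the integer part of [T] qualifies, it is at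
    least the next integer, which exceeds [T]. *)
Lemma disconnection_time_leE (G : sgraph) (Omega : Type)
    (X : nat -> Omega -> G * int) (w : Omega) (T : R) : 0 <= T ->
  (disconnection_time R X w <= T%:E)%E <->
  exists2 k, (k <= Num.truncn T)%N
    & disconnects (take k.+1 (traj X (Num.truncn T) w)).
Proof.
move=> T0; set m := Num.truncn T.
have takeE k : (k <= m)%N -> take k.+1 (traj X m w) = traj X k w.
  by move=> km; rewrite /traj -map_take take_iota (minn_idPl _).
split=> [le_T|[k km]]; last first.
  rewrite takeE // => dk; apply: ereal_inf_le; exists k%:R%:E; first by exists k.
  by rewrite lee_fin (@le_trans _ _ m%:R) ?ler_nat // truncn_le.
apply: contrapT => nex.
suff : (m.+1%:R%:E <= disconnection_time R X w)%E.
  by move/le_trans => /(_ _ le_T); rewrite lee_fin leNgt truncnS_gt.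
apply/ereal_infP => _ [k dk <-]; rewrite lee_fin ler_nat ltnNge.
by apply/negP => km; apply: nex; exists k; rewrite ?takeE.
Qed.

(** Replaces the random disconnection time by the fixed horizon, through a property [B] that a
    disconnecting prefix forces on the whole path. *)
Lemma prob_disconnection_le (G : sgraph) (d : measure_display)
    (Omega : measurableType d) (P : probability Omega R)
    (X : nat -> Omega -> G * int) (x : G * int) (T : R)
    (B : seq (G * int) -> bool) :
  is_srw P X x -> 0 <= T ->
  (forall k p, disconnects (take k p) -> B p) ->
  (P [set w | (disconnection_time R X w <= T%:E)%E]
   <= (walk_mean (Num.truncn T) (fun p => (B p)%:R) x)%:E)%E.
Proof.
move=> srw T0 dB; set m := Num.truncn T.
have -> : [set w | (disconnection_time R X w <= T%:E)%E] =
    [set w | (exists2 k, (k <= m)%N & disconnects (take k.+1 (traj X m w)))].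
  by apply/seteqP; split => w /=; rewrite disconnection_time_leE.
apply: le_trans (prob_traj_le srw m
  (fun p => exists2 k, (k <= m)%N & disconnects (take k.+1 p))) _.
rewrite lee_fin; apply: le_walk_mean => p _ _.
by case: asboolP => [[k _ /dB ->]|_] //; rewrite ler0n.
Qed.

Lemma prob_disconnection_small_gap (G : sgraph) (d : measure_display)
    (Omega : measurableType d) (P : probability Omega R)
    (X : nat -> Omega -> G * int) (x : G * int) (T : R) :
  is_srw P X x -> 0 <= T -> (2 <= #|G|)%N -> spectral_gap R G <= 1 ->
  (P [set w | (disconnection_time R X w <= T%:E)%E]
   <= (2 * (T * spectral_gap R G))%:E)%E.
Proof.
move=> srw T0 n2 l1.
apply: le_trans (prob_disconnection_le srw T0 (B := fun p => covers p) _) _.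
  move=> k p /disconnects_covers/forallP cov; apply/forallP => g.
  by have /hasP[y /mem_take yp yg] := cov g; apply/hasP; exists y.
rewrite lee_fin; apply: le_trans (walk_mean_covers _ x n2 l1) _.
by rewrite ler_wpM2l // ler_wpM2r ?spectral_gap_ge0 // truncn_le.
Qed.

Lemma prob_disconnection_local_time (G : sgraph) (d : measure_display)
    (Omega : measurableType d) (P : probability Omega R)
    (X : nat -> Omega -> G * int) (x : G * int) (T a : R) (D L : nat) :
  is_srw P X x -> 0 <= T -> (0 < D)%N -> (max_deg G <= D)%N -> (0 < #|G|)%N ->
  0 <= a <= 1 -> (0 < L)%N ->
  (8 * D * L)%:R <= spectral_gap R G * #|G|%:R -> (4 * L <= #|G|)%N ->
  (P [set w | (disconnection_time R X w <= T%:E)%E]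
   <= ((Num.truncn T).*2.+1%:R * (4 * (1 + a ^+ 2) ^+ Num.truncn T
        / visit_weight D a ^+ L))%:E)%E.
Proof.
move=> srw T0 D0 GD n0 a01 L0 L1 L2.
apply: le_trans (prob_disconnection_le srw T0
  (B := fun p => `[< exists z, (L <= local_time z p)%N >]) _) _; last first.
  by rewrite lee_fin; apply: max_local_time_tail.
move=> k p /(disconnects_slice (R := R) GD n0) [z Sz]; apply/asboolP; exists z.
have le_count : (local_time z (take k p) <= local_time z p)%N.
  by rewrite -[in leqRHS](cat_take_drop k p) /local_time count_cat leq_addr.
apply: leq_trans le_count; apply: leq_trans (slice_local_time _ _).
(* [L] lies below the slice size in both alternatives of [disconnects_slice]. *)
case: Sz => [/(le_trans L1)|/(leq_trans L2)]; last by rewrite leq_pmul2l.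
by rewrite ler_nat leq_pmul2l // muln_gt0.
Qed.

End Assembly.

(** * Numerical estimates for the large-gap regime *)

Section Asymptotics.
Context {R : realType}.
Implicit Types (n delta x t : R).

Lemma expR_half_le x : 0 <= x <= 1 -> expR (x / 2) <= 1 + x.
Proof.
move=> /andP[x0 x1]; have h := expR_ge1Dx (- (x / 2)).
have e0 := expR_gt0 (x / 2); rewrite expRN in h.
have : (1 - x / 2) * expR (x / 2) <= 1.
  by apply: le_trans (ler_wpM2r (ltW e0) h) _; rewrite mulVf // gt_eqF.
nra.
Qed.

Lemma expR_ge_exprn t q : 0 <= t -> (0 < q)%N -> (t / q%:R) ^+ q <= expR t.
Proof.
move=> t0 q0; have qR : q%:R != 0 :> R by rewrite pnatr_eq0 -lt0n.
rewrite -[in leRHS](divfK qR t) expRM_natr.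
rewrite lerXn2r ?nnegrE ?divr_ge0 ?expR_ge0 //.
by apply: le_trans (expR_ge1Dx _); rewrite lerDr.
Qed.

(** The choice [a = T ^ (-1/2)] keeps [(1 + a ^ 2) ^ T] below [e], while the visit weight to the
    power [L] is exponential in a positive power of [n] and beats the [n ^ 2] heights. *)
Lemma large_gap_estimate n delta (D q : nat) :
  1 <= n -> 0 < delta < 1 -> (0 < D)%N -> (16 * D)%:R <= n `^ (1 - delta / 10) ->
  4 <= q%:R * delta ->
  (Num.truncn (n `^ (2 * (1 - delta)))).*2.+1%:R
    * (4 * (1 + (n `^ (- (1 - delta))) ^+ 2) ^+ Num.truncn (n `^ (2 * (1 - delta)))
       / visit_weight D (n `^ (- (1 - delta)))
           ^+ Num.truncn (n `^ (1 - delta / 10) / (8 * D)%:R))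
  <= 12 * expR 1 * ((32 * D * D.+2)%:R * q%:R) ^+ q / n.
Proof.
move=> n1 /andP[d0 d1] D0 Dn qd.
have n0 : 0 < n by apply: lt_le_trans n1.
have nD r s : n `^ (r + s) = n `^ r * n `^ s.
  by rewrite powRD // (gt_eqF n0) implybT.
have q0 : (0 < q)%N by rewrite lt0n; apply/eqP => q0; move: qd; rewrite q0 mul0r; lra.
set T := n `^ (2 * (1 - delta)); set m := Num.truncn T.
set a := n `^ (- (1 - delta)); set y := _ / (8 * D)%:R; set L := Num.truncn y.
have a0 : 0 < a by apply: powR_gt0.
have aT : a ^+ 2 * T = 1.
  by rewrite expr2 /a /T -!nD [X in _ `^ X](_ : _ = 0) ?powRr0 //; ring.
have a1 : a <= 1 by rewrite -(powRr0 n) ler_powR //; lra.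
have T0 : 0 < T by apply: powR_gt0.
have mT : m%:R <= T by rewrite truncn_le ltW.
have DR : (1 : R) <= D%:R by rewrite ler1n.
have y0 : 0 < (8 * D)%:R :> R by rewrite ltr0n muln_gt0.
have y2 : 2 <= y by rewrite ler_pdivlMr // -natrM mulnA.
(* Truncation loses less than 1, at most half of [y] as [y >= 2]. *)
have Ly : y / 2 <= L%:R.
  by have := truncnS_gt y; rewrite -/L -natr1; lra.
clearbody m L.
have a20 : 0 <= a ^+ 2 by rewrite sqr_ge0.
have a21 : 0 <= 1 + a ^+ 2 by rewrite addr_ge0.
have growth : (1 + a ^+ 2) ^+ m <= expR 1.
  apply: (@le_trans _ _ (expR (a ^+ 2) ^+ m)).
    by rewrite lerXn2r ?nnegrE ?expR_ge0 ?expR_ge1Dx.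
  by rewrite -expRM_natr ler_expR (le_trans (ler_wpM2l a20 mT)) ?aT.
have count : m.*2.+1%:R <= 3 * n ^+ 2.
  have Tn : T <= n ^+ 2 by rewrite -powR_mulrn ?(ltW n0) // ler_powR //; lra.
  have : 1 <= n ^+ 2 by rewrite exprn_ege1.
  by rewrite -natr1 -muln2 natrM; lra.
set K : R := (32 * D * D.+2)%:R * q%:R.
have K0 : 0 < K by rewrite mulr_gt0 ?ltr0n ?muln_gt0 ?D0.
set W := visit_weight D a ^+ L.
have weight : n ^+ 3 <= K ^+ q * W.
  set x := a / D.+2%:R.
  have x01 : 0 <= x <= 1.
    rewrite divr_ge0 ?(ltW a0) //= ler_pdivrMr ?ltr0n // mul1r.
    by rewrite (le_trans a1) // ler1n.
  (* The exponent is [(1 - delta / 10) - (1 - delta)]; 32 collects the 8 of [y] and two halvings. *)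
  have xL : n `^ (delta * (9 / 10)) / (32 * D * D.+2)%:R <= x / 2 * L%:R.
    apply: (@le_trans _ _ (x / 2 * (y / 2))); last first.
      by rewrite ler_wpM2l // divr_ge0 //; case/andP: x01.
    rewrite (_ : delta * _ = - (1 - delta) + (1 - delta / 10)); last by field.
    rewrite nD -/a /x /y !natrM le_eqVlt; apply/orP; left; apply/eqP.
    field; rewrite ?pnatr_eq0 -?lt0n ?D0 //=.
  have W1 : expR (n `^ (delta * (9 / 10)) / (32 * D * D.+2)%:R) <= W.
    apply: (@le_trans _ _ (expR (x / 2) ^+ L)).
      by rewrite -expRM_natr ler_expR.
    by rewrite lerXn2r ?nnegrE ?expR_ge0 ?addr_ge0 ?expR_half_le //; case/andP: x01.
  have u0 : 0 <= n `^ (delta * (9 / 10)) / (32 * D * D.+2)%:R.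
    by rewrite divr_ge0 ?powR_ge0.
  have := le_trans (expR_ge_exprn u0 q0) W1.
  rewrite -mulrA -invfM -/K exprMn exprVn ler_pdivrMr ?exprn_gt0 // => h.
  rewrite [leRHS]mulrC; apply: le_trans h.
  rewrite -[leRHS]powR_mulrn ?powR_ge0 // -powRrM -powR_mulrn ?(ltW n0) //.
  (* The exponent [q delta 9 / 10] is at least [18 / 5], hence at least 3. *)
  by rewrite ler_powR //; lra.
have W0 : 0 < W.
  by rewrite exprn_gt0 // (lt_le_trans ltr01) // visit_weight_ge1 // ltW.
have Kq : 0 <= K ^+ q by rewrite exprn_ge0 // ltW.
have e0 := expR_gt0 (1 : R).
apply: (@le_trans _ _ (3 * n ^+ 2 * (4 * expR 1 / W))).
  apply: ler_pM => //; first by rewrite divr_ge0 ?(ltW W0) // mulr_ge0 // exprn_ge0.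
  by rewrite ler_wpM2r ?invr_ge0 ?(ltW W0) // ler_wpM2l.
rewrite ler_pdivlMr // [leLHS](_ : _ = 12 * expR 1 * n ^+ 3 / W); last first.
  by field; rewrite gt_eqF.
by rewrite ler_pdivrMr // -[leRHS]mulrA ler_wpM2l.
Qed.

End Asymptotics.

(** * Choice of a uniform size threshold and the two regimes *)

Theorem theorem4p3 (R : realType) (d0 : nat) (delta : R)
    (hd0 : (2 <= d0)%N) (hdelta0 : 0 < delta) (hdelta1 : delta < 1 / 2) :
  forall eps : R, 0 < eps ->
  exists N : nat, forall G : sgraph, Gext d0 delta G -> (N <= #|G|)%N ->
  forall (d : measure_display) (Omega : measurableType d)
    (P : G * int -> probability Omega R) (X : nat -> Omega -> G * int),
    (forall x : G * int, is_srw (P x) X x) ->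
    (ereal_sup [set P x [set w | disconnection_time R X w <=
                                 (#|G|%:R `^ (2 * (1 - delta)))%:E]
               | x in [set: G * int]] <= eps%:E)%E.
Proof.
move=> eps eps0.
have d0_gt0 : (0 < d0)%N by apply: leq_trans hd0.
pose q := (Num.truncn (4 / delta)).+1.
have qd : 4 <= q%:R * delta.
  by rewrite -ler_pdivrMr // ltW // truncnS_gt.
pose C : R := 12 * expR 1 * ((32 * d0 * d0.+2)%:R * q%:R) ^+ q.
have C0 : 0 <= C by rewrite mulr_ge0 ?exprn_ge0 ?mulr_ge0 ?expR_ge0.
(* The four terms ensure, in order: a truncated level [L] that is at least 1, [C / n <= eps],
   [2 / ln n <= eps], and [ln n >= 1], which keeps a small gap below 1. *)
pose B : R := (16 * d0)%:R ^+ 2 + C / eps + expR (2 / eps) + expR 1.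
exists (Num.truncn B).+1 => G [_ n2 Gd gap] NG d Omega P X srw.
set n : R := #|G|%:R in gap *.
have Bn : B < n by apply: lt_le_trans (truncnS_gt B) _; rewrite ler_nat.
have e0 t : 0 <= expR t :> R by rewrite expR_ge0.
have Ce : 0 <= C / eps by rewrite divr_ge0 // ltW.
have d2 : (0 : R) <= (16 * d0)%:R ^+ 2 by rewrite exprn_ge0.
have [nd nC n_eps n_e] : [/\ (16 * d0)%:R ^+ 2 <= n, C / eps <= n,
    expR (2 / eps) <= n & expR 1 <= n].
  have := e0 (2 / eps); have := e0 1.
  by move: Bn; rewrite /B; split; lra.
have n1 : 1 <= n by rewrite ler1n (leq_trans _ n2).
have n0 : 0 < n by apply: lt_le_trans n1.
have ln_ge t : expR t <= n -> t <= ln n.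
  by move=> tn; rewrite -(expRK t) ler_ln // posrE expR_gt0.
have T0 : 0 < n `^ (2 * (1 - delta)) by rewrite powR_gt0.
apply/ereal_supP => _ [x _ <-].
case: gap => [small|large].
  have ln1 := ln_ge _ n_e; have ln_eps := ln_ge _ n_eps.
  have ln0 : 0 < ln n by apply: lt_le_trans ln1.
  apply: le_trans (prob_disconnection_small_gap (srw x) (ltW T0) n2 _) _.
    apply: le_trans small _; rewrite -[leRHS]mulr1.
    rewrite ler_pM ?powR_ge0 ?invr_ge0 ?(ltW ln0) //.
      by rewrite -[leRHS](powRr0 n) ler_powR //; lra.
    by rewrite invf_le1.
  rewrite lee_fin; apply: (@le_trans _ _ (2 * (ln n)^-1)).
    rewrite ler_wpM2l //; apply: le_trans (ler_wpM2l (ltW T0) small) _.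
    by rewrite powRN mulrA mulfV ?gt_eqF // mul1r.
  by rewrite ler_pdivrMr // mulrC -ler_pdivrMr.
(* As [delta / 10 <= 1 / 2], the right side is at least the square root of [n]. *)
have y16 : (16 * d0)%:R <= n `^ (1 - delta / 10).
  apply: (@le_trans _ _ (n `^ 2^-1)); last by rewrite ler_powR //; lra.
  rewrite powR12_sqrt ?(ltW n0) // -[leLHS]ger0_norm ?ler0n // -sqrtr_sqr.
  exact: ler_wsqrtr.
have y0 : (0 : R) < (8 * d0)%:R by rewrite ltr0n muln_gt0.
have y_le : (Num.truncn (n `^ (1 - delta / 10) / (8 * d0)%:R))%:R * (8 * d0)%:R
    <= n `^ (1 - delta / 10).
  by rewrite -ler_pdivlMr // truncn_le divr_ge0 ?powR_ge0 // ltW.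
have y_le_n : n `^ (1 - delta / 10) <= n.
  by rewrite -[leRHS]powRr1 ?(ltW n0) // ler_powR //; lra.
apply: le_trans (prob_disconnection_local_time (a := n `^ (- (1 - delta)))
  (D := d0) (L := Num.truncn (n `^ (1 - delta / 10) / (8 * d0)%:R))
  (srw x) (ltW T0) d0_gt0 Gd _ _ _ _ _) _.
- exact: leq_trans n2.
- by rewrite powR_ge0 -[leRHS](powRr0 n) ler_powR //; lra.
- rewrite truncn_gt0 ler_pdivlMr // mul1r; apply: le_trans y16.
  by rewrite ler_nat leq_pmul2r.
- rewrite natrM mulrC; apply: le_trans y_le _.
  rewrite powRD ?(gt_eqF n0) ?implybT // powRr1 ?(ltW n0) // mulrC.
  by rewrite ler_wpM2r ?(ltW n0).
- rewrite -(ler_nat R) natrM mulrC; apply: le_trans y_le_n.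
  apply: le_trans y_le; rewrite ler_wpM2l // ler_nat.
  exact: leq_trans (leq_pmulr 8 d0_gt0).
rewrite lee_fin; apply: le_trans (large_gap_estimate n1 _ d0_gt0 y16 qd) _.
  by rewrite hdelta0 /=; lra.
by rewrite -/C ler_pdivrMr // [leRHS]mulrC -ler_pdivrMr.
Qed.
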